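(* Let $(P,\le)$ be a finite poset that is not a chain. The vertices of the probability functions polytope $\mathcal{Q}_P\subset\mathbb{R}^{\mathcal{A}(P)}$ all of whose coordinates lie in $\{0,1\}$ correspond, via $S\mapsto\chi_S$ (the characteristic function of $S$), to the order filters $S$ of the poset $(\mathcal{A}(P),\preceq_A)$ with the property that for every $u\in\mathcal{A}(P)$, $$u\in S\iff\tau(u)\notin S,$$ where $\tau((x,y))=(y,x)$. That is, $S\mapsto\chi_S$ is a bijection from the set of such order filters onto the set of $0/1$-vertices of $\mathcal{Q}_P$.
   Context: For $x,y$ in a poset $(P,\le)$, $x\parallel y$ means that neither $x\le y$ nor $y\le x$. A probability function on $P$ is a function $\pi:\{(x,y)\in P\times P\mid x\ne y\}\to[0,1]$ such that, for all $x,y,z\in P$ for which the values involved are defined: (1) $x\le y$ implies $\pi(x,y)=1$; (2) $x\neq y$ implies $\pi(x,y)+\pi(y,x)=1$; (3) $y<z$ implies $\pi(x,y)\le\pi(x,z)$; (4) $y<z$ implies $\pi(z,x)\le\pi(y,x)$. The set $\mathcal{A}(P)=\{(x,y)\in P\times P\mid x\parallel y\}$ is partially ordered by $\preceq_A$, the transitive closure of the relation $\le_A$ defined by: $(x,y)\le_A(u,v)$ iff ($x=u$ and $y\le v$) or ($y=v$ and $u\le x$). The probability functions polytope $\mathcal{Q}_P\subset\mathbb{R}^{\mathcal{A}(P)}$ is the set of all restrictions $\pi|_{\mathcal{A}(P)}$ of probability functions $\pi$ on $P$; it is a convex polytope. An order filter of a poset $(X,\le)$ is a subset $T\subseteq X$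 such that $y\in T$, $x\in X$, $y\le x$ imply $x\in T$. *)

(* Defs.v *)
From HB Require Import structures.
From Stdlib Require Import Relation_Operators.
From mathcomp Require Import all_boot all_order all_algebra.
From mathcomp Require Import boolp classical_sets functions reals.

Set Implicit Arguments.
Unset Strict Implicit.
Unset Printing Implicit Defensive.

Import Order.TTheory GRing.Theory Num.Theory.

(* ~ total (<=%O) says that the poset is not a chain, and x >< y that x and y
   are incomparable. *)

Section ProbabilityFunctions.
Local Open Scope ring_scope.
Context {d : Order.disp_t} (P : finPOrderType d).

Definition offdiag := {p : P * P | p.1 != p.2}.

Definition offpair (x y : P) (xy : x != y) : offdiag := exist _ (x, y) xy.

Definition probability_function (R : realType) (pi : offdiag -> R) : Prop :=
  [/\ forall p, 0 <= pi p <= 1,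
      forall x y (xy : x != y), (x <= y)%O -> pi (offpair xy) = 1,
      forall x y (xy : x != y) (yx : y != x),
        pi (offpair xy) + pi (offpair yx) = 1,
      forall x y z (xy : x != y) (xz : x != z),
        (y < z)%O -> pi (offpair xy) <= pi (offpair xz)
    & forall x y z (zx : z != x) (yx : y != x),
        (y < z)%O -> pi (offpair zx) <= pi (offpair yx)].

End ProbabilityFunctions.

Section IncomparablePairs.
Local Open Scope order_scope.
Context {d : Order.disp_t} (P : finPOrderType d).

Record incomp := Incomp {
  incomp_val : P * P;
  incompP : incomp_val.1 >< incomp_val.2 }.

HB.instance Definition _ := [isSub for incomp_val].
HB.instance Definition _ := [Finite of incomp by <:].

Lemma incomp_neq (u : incomp) : (val u).1 != (val u).2.
Proof. by apply: contraNneq (incompP u) => ->; rewrite comparablexx. Qed.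

Definition incomp_offdiag (u : incomp) : offdiag P :=
  exist _ (val u) (incomp_neq u).

Lemma tau_subproof (u : incomp) : (val u).2 >< (val u).1.
Proof. by rewrite comparable_sym incompP. Qed.

Definition tau (u : incomp) : incomp :=
  @Incomp ((val u).2, (val u).1) (tau_subproof u).

Definition leA : rel incomp := fun p q =>
  let: (x, y) := val p in
  let: (u, v) := val q in
  ((x == u) && (y <= v)) || ((y == v) && (u <= x)).

(* [connect] is the reflexive transitive closure; as leA is reflexive this is
   its transitive closure, see [preceqAP]. *)
Definition preceqA : rel incomp := connect leA.

Lemma leA_refl : reflexive leA.
Proof. by case=> -[x y] ?; rewrite /leA /= eqxx lexx. Qed.

Lemma preceqAP (p q : incomp) :
  reflect (clos_trans incomp leA p q) (preceqA p q).
Proof.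
apply: (iffP idP) => [/connectP[s]|].
  elim: s p => [|r s IHs] p /=; first by move=> _ ->; left; apply: leA_refl.
  case/andP=> pr sP qE; apply: (@t_trans _ _ _ r); first by left.
  exact: IHs.
elim=> [r s|r s t _ rs _ st]; first exact: connect1.
exact: connect_trans rs st.
Qed.

Lemma preceqA_coord (p q : incomp) :
  preceqA p q -> (val q).1 <= (val p).1 /\ (val p).2 <= (val q).2.
Proof.
move=> /preceqAP; elim=> {p q} [[[x y] ?] [[u v] ?]|p q r _ [? ?] _ [? ?]].
  by rewrite /leA /= => /orP[]/andP[/eqP-> ->].
by split; [apply: (@le_trans _ _ (val q).1)|apply: (@le_trans _ _ (val q).2)].
Qed.

Lemma preceqA_refl : reflexive preceqA.
Proof. exact: connect0. Qed.

Lemma preceqA_trans : transitive preceqA.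
Proof. exact: connect_trans. Qed.

Lemma preceqA_anti : antisymmetric preceqA.
Proof.
move=> p q /andP[/preceqA_coord[p1 p2] /preceqA_coord[q1 q2]].
apply: val_inj; rewrite [val p]surjective_pairing [val q]surjective_pairing.
by congr pair; apply: le_anti; rewrite ?p1 ?p2 ?q1 ?q2.
Qed.

End IncomparablePairs.

Fact incomp_display (d : Order.disp_t) : Order.disp_t. Proof. exact: d. Qed.

HB.instance Definition _ (d : Order.disp_t) (P : finPOrderType d) :=
  Order.Le_isPOrder.Build (incomp_display d) (incomp P)
    (@preceqA_refl d P) (@preceqA_anti d P) (@preceqA_trans d P).

Definition order_filter {d : Order.disp_t} {X : finPOrderType d}
    (T : {set X}) : Prop :=
  forall x y : X, y \in T -> (y <= x)%O -> x \in T.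

Section Polytope.
Local Open Scope ring_scope.
Local Open Scope classical_set_scope.
Context {d : Order.disp_t} (P : finPOrderType d) (R : realType).

Definition prob_polytope : set {ffun incomp P -> R} :=
  [set f | exists pi : offdiag P -> R,
     probability_function pi /\ f = [ffun u => pi (incomp_offdiag u)]].

(* A vertex is a face consisting of a single point, where a face of Q is
   the set of points of Q at which a linear inequality <c, w> <= b that is
   valid on Q holds with equality. *)
Definition vertex (I : finType) (Q : set {ffun I -> R}) (v : {ffun I -> R}) :=
  exists (c : {ffun I -> R}) (b : R),
    (forall w, Q w -> \sum_i c i * w i <= b) /\
    Q `&` [set w : {ffun I -> R} | \sum_i c i * w i = b] = [set v].

Definition charfun (I : finType) (S : {set I}) : {ffun I -> R} :=
  [ffun i => (i \in S)%:R].

End Polytope.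

Arguments prob_polytope {d} P R.
Arguments charfun R {I} S.

(* Main.v *)
(** A 0/1 point of a subset of the unit cube is always a vertex of it: the
    functional with coefficients 1 on the support and -1 off it is maximised
    over the cube at that point only.  So the 0/1 vertices are just the 0/1
    points, and for the characteristic function of [S] the monotonicity axioms
    say that [S] is closed under the generating relation of the order, while
    pi(x,y) + pi(y,x) = 1 says that [S] contains exactly one of [u], [tau u].
    Conversely such a characteristic function is extended by 1 on the pairs
    x < y and by 0 on the pairs y < x. *)
Require Import Defs.
From mathcomp Require Import all_boot all_order all_algebra.
From mathcomp Require Import boolp classical_sets functions reals.

Import Order.TTheory GRing.Theory Num.Theory.

Local Open Scope ring_scope.
Local Open Scope classical_set_scope.

Lemma vertex_mem {R : realType} {I : finType} {Q : set {ffun I -> R}}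
    {v : {ffun I -> R}} : vertex Q v -> Q v.
Proof.
move=> [c [b [_ E]]].
have : [set v] v by [].
by rewrite -E => -[].
Qed.

Lemma vertex_charfun {R : realType} {I : finType} {Q : set {ffun I -> R}}
    {S : {set I}} :
  (forall w, Q w -> forall i, 0 <= w i <= 1) -> Q (charfun R S) ->
  vertex Q (charfun R S).
Proof.
move=> Q01 QS.
pose c : {ffun I -> R} := [ffun i => if i \in S then 1 else -1].
(* The equality condition is carried along with the bound, so that after summation equality forces
   agreement with [charfun R S] in every coordinate. *)
have cw w i : 0 <= w i <= 1 ->
    c i * w i <= c i * charfun R S i ?= iff (w i == charfun R S i).
  move=> /andP[w0 w1]; rewrite !ffunE.
  by case: (i \in S); split;
    rewrite !(mul1r, mulN1r) /= ?oppr0 ?oppr_le0 ?oppr_eq0.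
have scw w : Q w -> \sum_i c i * w i <= \sum_i c i * charfun R S i
    ?= iff [forall i, w i == charfun R S i].
  by move=> Qw; apply: leif_sum => i _; apply/cw/Q01.
exists c, (\sum_i c i * charfun R S i); split.
  by move=> w /scw[].
apply/seteqP; split=> [w [Qw /= /eqP]|w -> //].
by rewrite (scw w Qw) => /forallP wS; apply/ffunP => i; apply/eqP.
Qed.

Lemma charfun_inj {R : realType} {I : finType} : injective (@charfun R I).
Proof.
move=> S T /ffunP ST; apply/setP => i; have := ST i; rewrite !ffunE.
by move/eqP; rewrite eqr_nat; case: (i \in S); case: (i \in T).
Qed.

Section ProbPolytope.
Context {R : realType} {d : Order.disp_t} {P : finPOrderType d}.
Implicit Types (f : {ffun incomp P -> R}) (u v : incomp P) (S : {set incomp P}).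

Lemma prob_polytope_cube {f u} : prob_polytope P R f -> 0 <= f u <= 1.
Proof. by move=> [pi [[pi01 _ _ _ _] ->]]; rewrite ffunE. Qed.

Lemma prob_polytope_tau {f u} : prob_polytope P R f -> f u + f (tau u) = 1.
Proof.
move=> [pi [[_ _ piC _ _] ->]]; rewrite !ffunE.
rewrite -(piC _ _ (incomp_neq u) (incomp_neq (tau u))).
by congr (pi _ + pi _); apply: val_inj; case: u => -[].
Qed.

Lemma prob_polytope_leA {f u v} :
  prob_polytope P R f -> leA u v -> f u <= f v.
Proof.
move=> [pi [[_ _ _ piR piL] ->]]; rewrite !ffunE.
case: u v => -[x y] xy [[x' y'] xy']; rewrite /leA /=.
(* The monotonicity axioms cover strict inequalities only. In the equality cases the two pairs
   coincide up to the proof of incomparability. *)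
case/orP=> /andP[/eqP e]; subst; rewrite le_eqVlt => /orP[/eqP e|lt].
- subst; rewrite (_ : @Incomp _ P _ xy = @Incomp _ P _ xy') //.
  exact: val_inj.
- have := piR _ _ _ (incomp_neq (@Incomp _ P (_, _) xy))
    (incomp_neq (@Incomp _ P (_, _) xy')) lt.
  by congr (pi _ <= pi _); apply: val_inj.
- subst; rewrite (_ : @Incomp _ P _ xy = @Incomp _ P _ xy') //.
  exact: val_inj.
- have := piL _ _ _ (incomp_neq (@Incomp _ P (_, _) xy))
    (incomp_neq (@Incomp _ P (_, _) xy')) lt.
  by congr (pi _ <= pi _); apply: val_inj.
Qed.

Lemma prob_polytope_homo {f} : prob_polytope P R f ->
  {homo f : u v / (u <= v)%O >-> u <= v}.
Proof.
move=> Qf u v /preceqAP; elim=> {u v} [u v|u v w _ uv _ vw].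
  exact: prob_polytope_leA.
exact: le_trans uv vw.
Qed.

(** [insub] fails exactly on comparable pairs, so the default [0] is reached only when the second
    entry lies strictly below the first. *)
Definition extend_charfun S (p : offdiag P) : R :=
  if ((val p).1 <= (val p).2)%O then 1
  else if insub (val p) is Some u then (u \in S)%:R else 0.

Lemma extend_charfun_incomp S u :
  extend_charfun S (incomp_offdiag u) = (u \in S)%:R.
Proof.
rewrite /extend_charfun /= valK.
by case: ifP (incompP u) => // le12; rewrite /Order.comparable le12.
Qed.

Lemma extend_charfun_ge {S x y} (xy : x != y) :
  (y <= x)%O -> extend_charfun S (offpair xy) = 0.
Proof.
move=> yx; rewrite /extend_charfun /=.
case: ifP => [xy'|_]; first by case/eqP: xy; apply/le_anti/andP.
by rewrite insubF //= /Order.comparable yx orbT.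
Qed.

Lemma probability_function_extend {S} : order_filter S ->
  (forall u, u \in S <-> tau u \notin S) ->
  probability_function (extend_charfun S).
Proof.
move=> filtS tauS.
have le1 x y (xy : x != y) : (x <= y)%O -> extend_charfun S (offpair xy) = 1.
  by rewrite /extend_charfun /= => ->.
have inc x y (xy : x != y) (xyN : (x >< y)%O) :
    extend_charfun S (offpair xy) = (@Incomp _ P (x, y) xyN \in S)%:R.
  by rewrite -extend_charfun_incomp; congr extend_charfun; apply: val_inj.
have E01 p : 0 <= extend_charfun S p <= 1.
  rewrite /extend_charfun; case: ifP => _; first by rewrite ler01 lexx.
  by case: insub => [u|]; rewrite ?lexx ?ler01 // ler0n lern1 leq_b1.
have EC x y (xy : x != y) (yx : y != x) :
    extend_charfun S (offpair xy) + extend_charfun S (offpair yx) = 1.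
  have [/orP[le|le]|xyN] := boolP (x >=< y)%O.
  - by rewrite le1 // extend_charfun_ge // addr0.
  - by rewrite (le1 y x) // extend_charfun_ge // add0r.
  have yxN : (y >< x)%O by rewrite comparable_sym.
  (* Exactly one of the two opposite pairs lies in [S], so the values are 1 and 0 in some order. *)
  rewrite !inc; have := tauS (@Incomp _ P (x, y) xyN).
  have -> : tau (@Incomp _ P (x, y) xyN) = @Incomp _ P (y, x) yxN.
    exact: val_inj.
  case: (_ \in S) => -[].
    by move=> /(_ isT) /negbTE -> _; rewrite addr0.
  by case: (_ \in S) => [_ _|_ /(_ isT)//]; rewrite add0r.
have ER x y z (xy : x != y) (xz : x != z) : (y < z)%O ->
    extend_charfun S (offpair xy) <= extend_charfun S (offpair xz).
  (* If [x <= z] the right side is 1; if [z <= x] then [y <= x] and the left side is 0. For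
     incomparable [x] and [z], [x <= y] would give [x <= z], and [y <= x] again makes the left side
     0. When both pairs are incomparable, they are related by one [leA] step and the filter property
     applies. *)
  move=> yz; have [/orP[le|le]|xzN] := boolP (x >=< z)%O.
  - by rewrite (le1 x z) //; case/andP: (E01 (offpair xy)).
  - rewrite extend_charfun_ge ?(le_trans (ltW yz)) //.
    by case/andP: (E01 (offpair xz)).
  have [/orP[le|le]|xyN] := boolP (x >=< y)%O.
  - by move: xzN; rewrite /Order.comparable (le_trans le (ltW yz)).
  - by rewrite extend_charfun_ge //; case/andP: (E01 (offpair xz)).
  rewrite !inc ler_nat.
  case xyS: (_ \in S) => //; rewrite (filtS _ _ xyS) //.
  by apply: connect1; rewrite /leA /= eqxx ltW.
(* Antitonicity in the first argument is [ER] read through the complement pi(z,x) = 1 - pi(x,z). *)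
split=> // x y z zx yx yz.
have xz : x != z by rewrite eq_sym.
have xy : x != y by rewrite eq_sym.
by rewrite -[leLHS](addrK (extend_charfun S (offpair xz)))
  -[leRHS](addrK (extend_charfun S (offpair xy))) !EC lerD2l lerN2 ER.
Qed.

End ProbPolytope.

Theorem theorem4p17 (R : realType) (d : Order.disp_t) (P : finPOrderType d)
    (hP : ~ total (<=%O : rel P)) :
  set_bij
    [set S : {set incomp P} |
       order_filter S /\ forall u : incomp P, u \in S <-> tau u \notin S]
    [set f : {ffun incomp P -> R} |
       vertex (prob_polytope P R) f /\ forall u : incomp P, f u = 0 \/ f u = 1]
    (charfun R).
Proof.
split.
- move=> S /= [filtS tauS]; split.
    apply: vertex_charfun => [w Qw u|]; first exact: prob_polytope_cube.
    exists (extend_charfun S); split; first exact: probability_function_extend.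
    by apply/ffunP => u; rewrite !ffunE extend_charfun_incomp.
  by move=> u; rewrite ffunE; case: (u \in S); [right|left].
- by move=> S T _ _ /charfun_inj.
move=> f /= [/vertex_mem Qf f01].
(* The preimage of a 0/1 point is its support. *)
exists [set u | f u == 1]%SET; last first.
  apply/ffunP => u; rewrite ffunE inE.
  by case: (f01 u) => ->; rewrite ?eqxx // eq_sym oner_eq0.
split=> [u v|u]; rewrite !inE.
  (* Monotonicity gives [1 <= f u], and the cube bound gives the reverse. *)
  move=> /eqP fv1 /(prob_polytope_homo Qf); rewrite fv1 => fu1.
  by rewrite eq_le fu1 andbT; case/andP: (prob_polytope_cube (u := u) Qf).
have := prob_polytope_tau (u := u) Qf.
case: (f01 u) => ->; rewrite ?add0r.
  by move=> ->; rewrite eqxx eq_sym oner_eq0.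
by rewrite -[RHS]addr0 => /addrI ->; rewrite eqxx eq_sym oner_eq0.
Qed.
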